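(* There does not exist an $8\times 8$ complex matrix $H$ all of whose entries are complex $15$th roots of unity and with $HH^\ast=8I_8$; that is, $\mathrm{BH}(8,15)=\emptyset$.
   Context: $\mathrm{BH}(n,q)$ denotes the set of $n\times n$ complex matrices with all entries complex $q$th roots of unity satisfying $HH^\ast=nI_n$, where $H^\ast$ is the conjugate transpose. *)

(* Defs.v *)
From HB Require Import structures.
From mathcomp Require Import all_boot all_order all_algebra.
From mathcomp Require Import complex.
From mathcomp Require Import classical_sets reals.

Set Implicit Arguments.
Unset Strict Implicit.
Unset Printing Implicit Defensive.

Import Order.TTheory GRing.Theory Num.Theory.
Local Open Scope ring_scope.
Local Open Scope classical_set_scope.
Local Open Scope sesquilinear_scope.

(* The complex numbers are R[i], for R any model of the reals; H ^t* is the
   conjugate transpose, from the library's spectral.v. *)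
Definition BH (R : realType) (n q : nat) : set 'M[R[i]]_n :=
  [set H : 'M[R[i]]_n | (forall i j, q.-unity_root (H i j)) /\
                        H *m H ^t* = n%:R%:M].
Arguments BH : clear implicits.

(* Main.v *)
(* The 8 terms of the inner product of two distinct rows form a vanishing sum
   of 15th roots of unity. Since the 15th cyclotomic polynomial is irreducible
   and 8 = 3 + 5 is the only way of writing 8 as 3 m + 5 n, the terms are a
   rotated regular triangle together with a rotated regular pentagon. Write the
   exponents of the entries as pairs (a, b) in Z/3 x Z/5. Then two rows of a
   differ by a constant plus a vector e_u - e_v, which forces a to be plus or
   minus a permutation matrix sg, up to adding constants to rows and columns.
   Moreover, at the columns sg i and sg j rows i and j of b differ by the same
   y_ij, and \sum_c zeta^(b_ic - b_jc) = 3 zeta^y_ij for a primitive 5th root of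
   unity zeta. Hence the matrix M = (zeta^y_ij), with y_ii = 0, is Hermitian of
   trace 8 and satisfies M^2 = 3 M + 5; its eigenvalues are (3 +- sqrt 29) / 2,
   so its trace cannot be 8. *)
Require Import Defs.
From mathcomp Require Import all_boot all_order all_algebra all_solvable all_field.
From mathcomp Require Import complex ring zify.
From mathcomp Require Import classical_sets reals.

Set Implicit Arguments.
Unset Strict Implicit.
Unset Printing Implicit Defensive.

Import GRing.Theory Num.Theory.

Section Butson.

Local Open Scope ring_scope.

(** * Roots of unity and cyclotomic polynomials *)

Lemma closed_prim_root_exists (C : numClosedFieldType) (n : nat) :
  (0 < n)%N -> {z : C | n.-primitive_root z}.
Proof.
move=> n_gt0; have [r Dp] := closed_field_poly_normal ('X^n - 1 : {poly C}).
move: Dp; rewrite lead_coefXnsubC // scale1r => Dp.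
have Ur : uniq r.
  by rewrite -separable_prod_XsubC -Dp separable_Xn_sub_1 // pnatr_eq0 -lt0n.
have Sr : size r = n.
  by apply: succn_inj; rewrite -(size_prod_XsubC r id) -Dp size_XnsubC.
have /(has_prim_root n_gt0) : all n.-unity_root r.
  by apply/allP => x rx; rewrite /root_of_unity/= Dp root_prod_XsubC.
rewrite Ur Sr leqnn => /(_ isT isT) hz; exists (nth 0 r (find n.-primitive_root r)).
exact: nth_find.
Qed.

(** As $X^n - 1$ is the product of the ['Phi_d] with $d \mid n$, [z] is a root of one of them; then
    $z^d = 1$, so $n \mid d$ and $d = n$. *)
Lemma root_Cyclotomic (F : numFieldType) (n : nat) (z : F) :
  n.-primitive_root z -> root (map_poly intr 'Phi_n) z.
Proof.
move=> zP; have n_gt0 := prim_order_gt0 zP.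
have : root (map_poly intr (\prod_(d <- divisors n) 'Phi_d)) z.
  rewrite (prod_Cyclotomic n_gt0) rmorphB rmorph1 /= map_polyXn.
  by rewrite /root !hornerE (prim_expr_order zP) subrr.
rewrite rmorph_prod /root horner_prod prodf_seq_eq0 => /hasP[d /=].
rewrite -dvdn_divisors // => dn dz.
have d_gt0 : (0 < d)%N := dvdn_gt0 n_gt0 dn.
suff zd : (n %| d)%N by have /eqP<- : d == n by rewrite eqn_dvd dn.
rewrite (prim_order_dvd zP) -subr_eq0.
have -> : z ^+ d - 1 = (map_poly intr ('X^d - 1)).[z].
  by rewrite rmorphB rmorph1 /= map_polyXn !hornerE.
rewrite -(prod_Cyclotomic d_gt0) rmorph_prod (big_rem d) ?divisors_id //= hornerM.
by rewrite (eqP dz) mul0r.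
Qed.

(** Irreducibility of ['Phi_n] over the rationals, carried over from [algC], where it is a minimal
    polynomial, to any [F]. *)
Lemma prim_root_rat_indep (F : numFieldType) (n : nat) (z : F) (q : {poly rat}) :
  n.-primitive_root z -> (size q <= totient n)%N ->
  root (map_poly ratr q) z -> q = 0.
Proof.
move=> zP sq rq; have n_gt0 := prim_order_gt0 zP.
have [y yP] := C_prim_root_exists n_gt0.
have [p [Dp _] pP] := minCpolyP y.
have {}Dp : p = map_poly intr 'Phi_n.
  apply: (map_poly_inj (ratr : {rmorphism rat -> algC})).
  rewrite -Dp (minCpoly_cyclotomic yP) -(Cintr_Cyclotomic yP) -map_poly_comp.
  by apply: eq_map_poly => c /=; rewrite ratr_int.
have sp : size p = (totient n).+1.
  rewrite Dp size_map_poly_id0 ?size_Cyclotomic //.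
  by rewrite intr_eq0 lead_coef_eq0 -size_poly_eq0 size_Cyclotomic.
have rp : root (map_poly ratr p) z.
  rewrite Dp -map_poly_comp (eq_map_poly (g := intr)) ?root_Cyclotomic // => c /=.
  exact: ratr_int.
apply: contraTeq rq => q0.
have p0 : p != 0 by rewrite -size_poly_eq0 sp.
(* [y] is a root of the gcd or of its cofactor, so [p] divides one of them; the size of [q] rules
   out the gcd, which is then constant. *)
have : coprimep p q.
  have /dvdpP[h Dh] : gcdp p q %| p := dvdp_gcdl p q.
  have g0 : gcdp p q != 0 by rewrite gcdp_eq0 negb_and p0.
  have h0 : h != 0 by apply: contraNneq p0 => h0; rewrite Dh h0 mul0r.
  have : root (map_poly ratr p) y by rewrite pP.
  rewrite {1}Dh rmorphM rootM !pP => /orP[/(dvdp_leq h0)|/(dvdp_leq g0) le_p].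
    rewrite {1}Dh size_mul // /coprimep => le_h.
    move: g0 h0 le_h; rewrite -!size_poly_gt0.
    by move: (size _) (size _) => g' h'; lia.
  have := leq_trans le_p (dvdp_leq q0 (dvdp_gcdr p q)).
  by rewrite sp => /leq_trans/(_ sq); rewrite ltnn.
rewrite -(coprimep_map (ratr : {rmorphism rat -> F})) => /coprimep_root/(_ rp).
by rewrite /root.
Qed.

(** * The trace obstruction *)

(** For a full-rank factorization $P = AB$, cancelling in $ABAB = AB$ leaves $BA = 1$, of size the
    rank and of the same trace as $P$. *)
Lemma mxtrace_idempotent (F : fieldType) (n : nat) (P : 'M[F]_n) :
  P *m P = P -> \tr P = (\rank P)%:R.
Proof.
move=> PP; rewrite -{1}(mulmx_base P) mxtrace_mulC.
suff -> : row_base P *m col_base P = 1%:M by rewrite mxtrace1.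
apply: (row_free_inj (row_base_free P)); apply: (row_full_inj (col_base_full P)).
rewrite mul1mx; move: (col_base P) (row_base P) (mulmx_base P) => A B AB.
by rewrite !mulmxA AB -mulmxA AB PP.
Qed.

(* [(2 M - 3)^2 = 29] makes [(1 + (2 M - 3) / sqrt 29) / 2] an idempotent,
   whose trace would have to be an integer. *)
Lemma no_quadratic_trace (C : numClosedFieldType) (M : 'M[C]_8) :
  M *m M = 3%:R *: M + 5%:R%:M -> \tr M = 8%:R -> False.
Proof.
move=> MM trM; pose s : C := sqrtC 29%:R.
have ss : s * s = 29%:R by rewrite -expr2 sqrtCK.
have s0 : s != 0 by rewrite sqrtC_eq0 pnatr_eq0.
pose P := (2%:R * s)^-1 *: ((s - 3%:R)%:M + 2%:R *: M).
have k2s : (2%:R * s)^-1 * (2%:R * s) = 1.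
  by rewrite mulVf // mulf_neq0 // pnatr_eq0.
have PP : P *m P = P.
  rewrite /P -scalemxAl -scalemxAr scalerA mulmxDl !mulmxDr -!scalemxAl -!scalemxAr MM.
  rewrite !mul_mx_scalar mul_scalar_mx.
  apply/matrixP => i j; rewrite !mxE.
  transitivity ((2%:R * s)^-1 * ((2%:R * s)^-1 * (2%:R * s)) *
                ((s - 3%:R) *+ (i == j) + 2%:R * M i j)); last by rewrite k2s mulr1.
  by move: (_^-1) => k; case: (i == j); rewrite ?mulr1n ?mulr0n; ring: ss.
have := mxtrace_idempotent PP; rewrite /P mxtraceZ mxtraceD mxtrace_scalar mxtraceZ trM.
set r := \rank _ => /(congr1 ( *%R (2%:R * s))).
rewrite mulrA [_ * _^-1]mulrC k2s mul1r => e.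
(* The trace of [P] gives $2sr = 8(s - 3) + 16$. *)
have {e} : s * (8%:R - 2%:R * r%:R) = 8%:R.
  transitivity ((s - 3%:R) *+ 8 + 2%:R * 8%:R - 2%:R * s * r%:R + 8%:R).
    by ring.
  by rewrite e subrr add0r.
move=> /(congr1 (fun x => x * x)).
have -> : s * (8%:R - 2%:R * r%:R) * (s * (8%:R - 2%:R * r%:R))
   = (s * s) * (8%:R - 2%:R * r%:R) * (8%:R - 2%:R * r%:R) by ring.
rewrite ss.
have -> : 29%:R * (8%:R - 2%:R * r%:R) * (8%:R - 2%:R * r%:R) =
    (29 * (8 - 2 * r%:Z) * (8 - 2 * r%:Z))%:~R :> C.
  by rewrite !rmorphM !rmorphB !rmorphM /= -pmulrn.
rewrite (_ : 8%:R * 8%:R = 64%:~R :> C); last by rewrite -natrM.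
(* $29 (8 - 2r)^2 = 64$ has no integer solution, as 29 does not divide 64. *)
by move/intr_inj; nia.
Qed.

(** * Vanishing sums of eight 15th roots of unity *)

(** The relation splits [F s t] as $g(s) + h(t)$, where the minimality of [m] keeps $g$ nonnegative;
    then $5 \sum g + 3 \sum h = 8$ forces both sums to be 1. *)
Lemma grid_sum8 (F : 'I_3 -> 'I_5 -> nat) :
  (forall s t, F s t + F ord0 ord0 = F s ord0 + F ord0 t)%N ->
  (\sum_s \sum_t F s t = 8)%N ->
  exists x y, forall s t, F s t = ((s == x) + (t == y))%N.
Proof.
move=> Fst sF; pose m := [arg min_(s < ord0) F s ord0]%N.
have Fm s : (F m ord0 <= F s ord0)%N.
  by rewrite /m; case: arg_minnP => // i _; apply.
pose g s := (F s ord0 - F m ord0)%N.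
have FE s t : F s t = (g s + F m t)%N.
  by have := Fst s t; have := Fst m t; have := Fm s; rewrite /g; lia.
have : (5 * \sum_s g s + 3 * \sum_t F m t = 8)%N.
  rewrite -sF; under [RHS]eq_bigr => s _ do under eq_bigr => t _ do rewrite FE.
  under [RHS]eq_bigr => s _ do rewrite big_split /= sum_nat_const card_ord.
  by rewrite big_split /= sum_nat_const card_ord big_distrr.
move=> e; have /eqP/sum_nat_eq1[x [_ gx g0]] : (\sum_s g s = 1)%N by lia.
have /eqP/sum_nat_eq1[y [_ hy h0]] : (\sum_t F m t = 1)%N by lia.
exists x, y => s t; rewrite FE; congr (_ + _)%N.
  by case: eqVneq => [->|/g0->].
by case: eqVneq => [->|/h0->].
Qed.

(* [(10 s + 6 t) %% 15] is the residue congruent to [s] mod 3 and to [t] mod 5. *)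
Lemma vanishing_sum15 (F : numFieldType) (z : F) (f : nat -> nat) :
  15.-primitive_root z -> \sum_(m < 15) (f m)%:R * z ^+ m = 0 ->
  forall (s : 'I_3) (t : 'I_5),
    (f ((10 * s + 6 * t) %% 15) + f 0 = f ((10 * s) %% 15) + f ((6 * t) %% 15))%N.
Proof.
move=> zP zf.
pose g m : int := (f m)%:Z.
(* The coefficients of [\sum_m f m X^m] modulo the 15th cyclotomic polynomial
   [X^8 - X^7 + X^5 - X^4 + X^3 - X + 1]. *)
pose c : seq int :=
 [:: g 0%N - g 8%N - g 9%N - g 10%N + g 13%N + g 14%N;
     g 1%N + g 8%N - g 11%N - g 13%N;
     g 2%N + g 9%N - g 12%N - g 14%N;
     g 3%N - g 8%N - g 9%N + g 14%N;
     g 4%N + g 8%N - g 13%N - g 14%N;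
     g 5%N - g 8%N - g 10%N + g 13%N;
     g 6%N - g 9%N - g 11%N + g 14%N;
     g 7%N + g 8%N + g 9%N - g 12%N - g 13%N - g 14%N].
pose q : {poly rat} := map_poly intr (Poly c).
have q0 : q = 0.
  apply: (prim_root_rat_indep zP); first by apply: leq_trans (size_poly _ _) (size_Poly _).
  rewrite -map_poly_comp (eq_map_poly (g := intr)); last by move=> ? /=; rewrite ratr_int.
  (* In $z^{15} - 1 = (z^5 - 1)(z^2 + z + 1)\Phi_{15}(z)$ only the last factor can vanish, since [z]
     is primitive. *)
  have z8 : z ^+ 8 = z ^+ 7 - z ^+ 5 + z ^+ 4 - z ^+ 3 + z - 1.
    apply/eqP; rewrite -subr_eq0; set Q := _ - _.
    have : (z ^+ 5 - 1) * (z ^+ 2 + z + 1) * Q = 0.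
      transitivity (z ^+ 15 - 1); first by rewrite /Q; ring.
      by rewrite (prim_expr_order zP) subrr.
    move=> /eqP; rewrite !mulf_eq0 subr_eq0 -(prim_order_dvd zP) /= => /orP[z2|//].
    have /eqP: z ^+ 3 = 1.
      have -> : z ^+ 3 = (z - 1) * (z ^+ 2 + z + 1) + 1 by ring.
      by rewrite (eqP z2) mulr0 add0r.
    by rewrite -(prim_order_dvd zP).
  rewrite map_Poly_id0 ?rmorph0 // /root horner_Poly -zf !big_ord_recr big_ord0 /=.
  by apply/eqP; rewrite /g !(rmorphB, rmorphD) /= -!pmulrn; ring: z8.
have c0 i : c`_i = 0.
  by apply: (@intr_inj rat); rewrite -coef_Poly -[LHS]coef_map /= -/q q0 coef0.
move: (c0 0%N) (c0 1%N) (c0 2%N) (c0 3%N) (c0 4%N) (c0 5%N) (c0 6%N) (c0 7%N).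
rewrite /= /g.
move=> e0 e1 e2 e3 e4 e5 e6 e7 s t.
(* Each of the fifteen relations is a linear consequence of the eight vanishing coefficients. *)
case: s => [[|[|[|//]]] hs]; case: t => [[|[|[|[|[|//]]]]] ht];
  repeat match goal with |- context [(?a %% 15)%N] =>
  let v := eval vm_compute in (a %% 15)%N in change (a %% 15)%N with v end; lia.
Qed.

(** On the grid $Z/3 \times Z/5$ of exponents, the line $s = x$ is the pentagon and the line $t = y$
    the triangle. *)
Lemma vanishing_sum8 (F : numFieldType) (z : F) (I : finType) (k : I -> nat) :
  15.-primitive_root z -> #|I| = 8%N -> \sum_c z ^+ k c = 0 ->
  exists (x : 'Z_3) (y : 'Z_5), forall s t,
    #|[pred c | ((k c)%:R == s) && ((k c)%:R == t)]| = ((s == x) + (t == y))%N.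
Proof.
move=> zP cI zk; pose f m := #|[pred c | (k c %% 15)%N == m]|.
pose K c : 'I_15 := inord (k c %% 15).
have KE c : K c = (k c %% 15)%N :> nat by rewrite inordK // ltn_pmod.
have fK (m : 'I_15) : f m = #|[pred c | K c == m]|.
  by apply: eq_card => c; rewrite !inE -KE.
have zf : \sum_(m < 15) (f m)%:R * z ^+ m = 0.
  rewrite -[RHS]zk [RHS](partition_big K xpredT) //=; apply: eq_bigr => m _.
  rewrite fK -sum1_card natr_sum mulr_suml; apply: eq_big => [c|c /eqP <-].
    by rewrite inE.
  by rewrite mul1r KE (prim_expr_mod zP).
have Fst (s : 'I_3) (t : 'I_5) :
    #|[pred c | ((k c)%:R == s :> 'Z_3) && ((k c)%:R == t :> 'Z_5)]| =
    f ((10 * s + 6 * t) %% 15)%N.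
  apply: eq_card => c; rewrite !inE -!val_eqE /= !val_Zp_nat //.
  move: (k c) => n; apply/idP/idP;
  case: s => [[|[|[|//]]] hs]; case: t => [[|[|[|[|[|//]]]]] ht]; rewrite /=; lia.
have [||x [y E]] := @grid_sum8 (fun s t => f ((10 * s + 6 * t) %% 15)%N).
- by move=> s t; rewrite (vanishing_sum15 zP zf) muln0 addn0.
- rewrite -[RHS]cI -sum1_card (partition_big (fun c => (k c)%:R : 'Z_3) xpredT) //=.
  apply: eq_bigr => s _; rewrite (partition_big (fun c => (k c)%:R : 'Z_5) xpredT) //=.
  by apply: eq_bigr => t _; rewrite -Fst sum1_card.
by exists x, y => s t; rewrite Fst E.
Qed.

(** * A triangle and a pentagon in coordinates *)

Section TrianglePentagon.

Variables (I : finType) (x : I -> 'Z_3) (y : I -> 'Z_5) (x0 : 'Z_3) (y0 : 'Z_5).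
Hypothesis xy : forall s t,
  #|[pred c | (x c == s) && (y c == t)]| = ((s == x0) + (t == y0))%N.

Lemma triangle_pentagon_off c : x c != x0 -> y c = y0.
Proof.
move=> xc; apply/eqP/contraT => yc; have := xy (x c) (y c).
rewrite (negPf xc) (negPf yc) => /card0_eq/(_ c).
by rewrite inE !eqxx.
Qed.

(** The pentagon and one vertex of the triangle lie over [x0]; the other two vertices, [u] and [v],
    lie over [x0 + 1] and [x0 - 1]. *)
Lemma triangle_pentagon_delta :
  exists u v, u != v /\ forall c, x c = x0 + ((c == u)%:R - (c == v)%:R).
Proof.
have ex s : s != x0 -> exists u, x u = s /\ forall c, x c = s -> c = u.
  move=> sx0; have := xy s y0; rewrite (negPf sx0) eqxx => /mem_card1[u Eu].
  have E c : (x c == s) && (y c == y0) = (c == u) by have := Eu c; rewrite !inE.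
  exists u; have /andP[/eqP xu _] : (x u == s) && (y u == y0) by rewrite E.
  split=> // c xc; apply/eqP; rewrite -E xc eqxx /=.
  by rewrite triangle_pentagon_off // xc.
have [u [xu uP]] : exists u, x u = x0 + 1 /\ forall c, x c = x0 + 1 -> c = u.
  by apply: ex; rewrite -subr_eq0 addrC addKr.
have [v [xv vP]] : exists v, x v = x0 - 1 /\ forall c, x c = x0 - 1 -> c = v.
  by apply: ex; rewrite -subr_eq0 addrC addKr.
have uv : u != v.
  by apply/eqP => uv; move: xu; rewrite uv xv => /addrI.
exists u, v; split=> // c.
have [->|cu] := eqVneq c u; first by rewrite (negPf uv) subr0.
have [->|cv] := eqVneq c v; first by rewrite sub0r.
rewrite subrr addr0.
have : (x c - x0 == 0) || (x c - x0 == 1) || (x c - x0 == -1).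
  by case: (x c - x0) => [[|[|[|//]]] ?].
rewrite !subr_eq => /orP[/orP[/eqP->|/eqP e]|/eqP e].
- by rewrite add0r.
- by move: cu; rewrite (uP c) ?eqxx // e addrC.
- by move: cv; rewrite (vP c) ?eqxx // e addrC.
Qed.

(** The pentagon meets each [t] once, and the triangle lies wholly over [y0]. *)
Lemma triangle_pentagon_sum (F : comPzRingType) (h : 'Z_5 -> F) :
  \sum_c h (y c) = \sum_t h t + 3%:R * h y0.
Proof.
transitivity (\sum_(s : 'Z_3) \sum_(t : 'Z_5) ((s == x0) + (t == y0))%:R * h t).
  rewrite (partition_big x xpredT) //=; apply: eq_bigr => s _.
  rewrite (partition_big y xpredT) //=; apply: eq_bigr => t _.
  rewrite -xy -sum1_card natr_sum mulr_suml; apply: eq_big => [c|c /andP[_ /eqP->]].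
    by rewrite inE.
  by rewrite mul1r.
under eq_bigr => s _ do under eq_bigr => t _ do rewrite natrD mulrDl.
under eq_bigr => s _ do rewrite big_split /=.
rewrite big_split /= exchange_big /=; congr (_ + _).
  apply: eq_bigr => t _; rewrite (bigD1 x0) //= eqxx mul1r big1 ?addr0 // => s /negPf->.
  by rewrite mul0r.
rewrite sumr_const card_ord [RHS]mulr_natl; congr (_ *+ _).
rewrite (bigD1 y0) //= eqxx mul1r big1 ?addr0 // => t /negPf->.
by rewrite mul0r.
Qed.

End TrianglePentagon.

(** * The exponents mod 3 and their permutation *)

Lemma ord8_avoid (l : seq 'I_8) : (size l < 8)%N -> exists c, c \notin l.
Proof.
move=> sl; apply/existsP; rewrite -negb_forall; apply: contraL sl => /forallP lP.
rewrite -leqNgt -{1}[8%N]card_ord; apply: leq_trans (card_size l).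
by apply/subset_leq_card/fintype.subsetP => c _; rewrite lP.
Qed.

Local Notation delta u c := ((c == u)%:R : 'Z_3).

(** A column away from all six indices gives $d = 0$, so the left side has support $\{u, v\}$.
    Unless one end cancels, [p], [q], [r], [s] all lie there; the pair is then reversed, which is
    possible because $2 = -1$ mod 3. *)
Lemma delta_pair_share (p q r s u v : 'I_8) (d : 'Z_3) :
  p != q -> r != s -> u != v ->
  (forall c, (delta p c - delta q c) - (delta r c - delta s c)
             = d + (delta u c - delta v c)) ->
  [|| (p == r) && (q != s), (q == s) && (p != r) | (p == s) && (q == r)].
Proof.
move=> pq rs uv E.
have d0 : d = 0.
  have [c] := @ord8_avoid [:: p; q; r; s; u; v] isT.
  rewrite !inE !negb_or.
  move=> /and5P[/negPf cp /negPf cq /negPf cr /negPf cs /andP[/negPf cu /negPf cv]].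
  by have := E c; rewrite cp cq cr cs cu cv !subr0 addr0 => <-.
have supp c : (delta p c - delta q c) - (delta r c - delta s c) != 0 ->
    c = u \/ c = v.
  rewrite E d0 add0r; have [->|_] := eqVneq c u; first by left.
  by have [->|_] := eqVneq c v; [right|rewrite subrr eqxx].
have [epr|pr] := eqVneq p r; have [eqs|qs] //= := eqVneq q s.
  by have := E u; rewrite epr eqs subrr d0 add0r eqxx (negPf uv).
have pP : p = u \/ p = v.
  by apply: supp; rewrite eqxx (negPf pq) (negPf pr); case: (p == s).
have qP : q = u \/ q = v.
  by apply: supp; rewrite eqxx [q == p]eq_sym (negPf pq) (negPf qs); case: (q == r).
have rP : r = u \/ r = v.
  by apply: supp; rewrite eqxx [r == p]eq_sym (negPf pr) (negPf rs); case: (r == q).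
have sP : s = u \/ s = v.
  apply: supp; rewrite eqxx [s == q]eq_sym [s == r]eq_sym (negPf qs) (negPf rs).
  by case: (s == p).
case: pP qP rP sP pq pr qs rs => -> [] -> [] -> [] ->; rewrite ?eqxx //.
Qed.

Definition rows_delta (a : 'I_8 -> 'I_8 -> 'Z_3) :=
  forall i j, i != j -> exists x u v, u != v /\
    forall c, a i c - a j c = x + (delta u c - delta v c).

(** Row [i] minus row [ord0] is an arc from [p i] to [q i]. Any two arcs share exactly one end, so
    all seven share their tail ($e = 1$) or all their head ($e = -1$): [sg ord0] is this common end,
    [sg i] the other end of arc [i]. *)
Lemma rows_delta_star (a : 'I_8 -> 'I_8 -> 'Z_3) : rows_delta a ->
  exists (e : 'Z_3) (r : 'I_8 -> 'Z_3) (sg : 'I_8 -> 'I_8),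
    [/\ e != 0, injective sg &
      forall i c, a i c - a ord0 c = r i + e * (delta (sg ord0) c - delta (sg i) c)].
Proof.
move=> aP.
have star e x P (w : 'I_8 -> 'I_8) : e != 0 ->
    (forall i, i != ord0 -> P != w i) ->
    (forall i j, i != ord0 -> j != ord0 -> i != j -> w i != w j) ->
    (forall i c, i != ord0 -> a i c - a ord0 c = x i + e * (delta P c - delta (w i) c)) ->
  exists (e : 'Z_3) (r : 'I_8 -> 'Z_3) (sg : 'I_8 -> 'I_8),
    [/\ e != 0, injective sg &
      forall i c, a i c - a ord0 c = r i + e * (delta (sg ord0) c - delta (sg i) c)].
  move=> e0 wP winj aE; pose sg i := if i == ord0 then P else w i.
  exists e, (fun i => if i == ord0 then 0 else x i), sg; split=> //.
    move=> i j; rewrite /sg; have [->|i0] := eqVneq i ord0; have [->|j0] := eqVneq j ord0 => //.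
    - by move/eqP; rewrite (negPf (wP _ j0)).
    - by move/eqP; rewrite eq_sym (negPf (wP _ i0)).
    - by move/eqP; apply: contraTeq => ij; apply: winj.
  move=> i c; rewrite /sg eqxx; have [->|i0] := eqVneq i ord0; last exact: aE.
  by rewrite !subrr mulr0 addr0.
have /fin_all_exists[f fP] : forall i : 'I_8, exists f : 'Z_3 * ('I_8 * 'I_8),
    i != ord0 -> f.2.1 != f.2.2 /\
    forall c, a i c - a ord0 c = f.1 + (delta f.2.1 c - delta f.2.2 c).
  move=> i; have [->|i0] := eqVneq i ord0; first by exists (0, (ord0, ord0)).
  by have [x [u [v uv]]] := aP _ _ i0; exists (x, (u, v)).
pose p i := (f i).2.1; pose q i := (f i).2.2.
have pq i : i != ord0 -> p i != q i by case/fP.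
have aE i c : i != ord0 -> a i c - a ord0 c = (f i).1 + (delta (p i) c - delta (q i) c).
  by case/fP.
have share i j : i != ord0 -> j != ord0 -> i != j ->
    [|| (p i == p j) && (q i != q j), (q i == q j) && (p i != p j)
      | (p i == q j) && (q i == p j)].
  move=> i0 j0 ij; have [x [u [v [uv E]]]] := aP _ _ ij.
  apply: (@delta_pair_share _ _ _ _ u v (x - (f i).1 + (f j).1)); rewrite ?pq // => c.
  have := E c; rewrite -(subrK (a ord0 c) (a i c)) -(subrK (a ord0 c) (a j c)) !aE //.
  move=> {}E; transitivity (x + (delta u c - delta v c) - (f i).1 + (f j).1); last by ring.
  by rewrite -E; ring.
pose o1 : 'I_8 := inord 1; pose o2 : 'I_8 := inord 2.
have third (i j : 'I_8) : exists k, [/\ k != ord0, k != i & k != j].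
  have [k] := @ord8_avoid [:: ord0; i; j] isT.
  by rewrite !inE !negb_or => /and3P[]; exists k.
(* No third arc is compatible with both $A \to B$ and $B \to A$: it would be a loop or repeat one of
   them. *)
have norev i j : i != ord0 -> j != ord0 -> i != j -> ~~ ((p i == q j) && (q i == p j)).
  move=> i0 j0 ij; apply/negP => /andP[/eqP e1 /eqP e2].
  have [k [k0 ki kj]] := third i j.
  have := pq _ i0; have := pq _ k0.
  have := share k i k0 i0 ki; have := share k j k0 j0 kj; rewrite -e1 -e2.
  move: (p i) (q i) (p k) (q k) => A B X Y.
  case: (eqVneq X A) => [?|/eqP ?]; case: (eqVneq Y B) => [?|/eqP ?];
  case: (eqVneq X B) => [?|/eqP ?]; case: (eqVneq Y A) => [?|/eqP ?] //=;
  move=> _ _ /eqP ? /eqP ?; congruence.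
have share2 i j : i != ord0 -> j != ord0 -> i != j ->
    (p i == p j) && (q i != q j) || (q i == q j) && (p i != p j).
  by move=> i0 j0 ij; have := share _ _ i0 j0 ij; rewrite (negPf (norev _ _ i0 j0 ij)) orbF.
have o10 : o1 != ord0 by rewrite -val_eqE /= inordK.
have o20 : o2 != ord0 by rewrite -val_eqE /= inordK.
have o12 : o1 != o2 by rewrite -val_eqE /= !inordK.
have := share2 _ _ o10 o20 o12 => /orP[/andP[/eqP p12 q12]|/andP[/eqP q12 p12]].
  (* An arc with another tail would share its head with both [o1] and [o2], whose heads differ. *)
  have pE i : i != ord0 -> p i = p o1.
    move=> i0; have [->//|i1] := eqVneq i o1; have [->//|i2] := eqVneq i o2.
    have := share2 _ _ i0 o10 i1; have := share2 _ _ i0 o20 i2; rewrite -p12.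
    case: eqVneq => //= _; rewrite !andbT => /eqP-> /eqP q21.
    by rewrite q21 eqxx in q12.
  apply: (star 1 (fun i => (f i).1) (p o1) q) => //.
  - by move=> i i0; rewrite -(pE i) ?pq.
  - move=> i j i0 j0 ij; have := share2 _ _ i0 j0 ij.
    by rewrite !pE // eqxx andbF orbF.
  - by move=> i c i0; rewrite mul1r -(pE i) ?aE.
have qE i : i != ord0 -> q i = q o1.
  move=> i0; have [->//|i1] := eqVneq i o1; have [->//|i2] := eqVneq i o2.
  have := share2 _ _ i0 o10 i1; have := share2 _ _ i0 o20 i2; rewrite -q12.
  case: (eqVneq (q i)) => //= _; rewrite !andbT !orbF => /eqP-> /eqP p21.
  by rewrite p21 eqxx in p12.
apply: (star (-1) (fun i => (f i).1) (q o1) p) => //.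
- by move=> i i0; rewrite -(qE i) // eq_sym pq.
- move=> i j i0 j0 ij; have := share2 _ _ i0 j0 ij.
  by rewrite !qE // eqxx andbF.
- by move=> i c i0; rewrite mulN1r opprB -(qE i) ?aE.
Qed.

(** * The exponents mod 5 and the contradiction *)

Lemma conjC_unity_root (C : numClosedFieldType) (n : nat) (w : C) :
  n.+1.-unity_root w -> w^* = w ^+ n.
Proof.
move=> /unity_rootP wn.
have w1 : `|w| = 1.
  by apply/eqP; rewrite -(@pexpr_eq1 _ _ n.+1) // -normrX wn normr1.
have w0 : w != 0 by rewrite -normr_eq0 w1 oner_eq0.
by apply: (mulfI w0); rewrite -exprS wn -normCK w1 expr1n.
Qed.

(** At columns [sg i] and [sg j] the difference of the rows of [a] departs from its generic value,
    which is the pentagon's [x]; both columns thus belong to the triangle, where the rows of [b]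
    differ by [y]. *)
Lemma triangle_pentagon_rows (a : 'I_8 -> 'I_8 -> 'Z_3) (b : 'I_8 -> 'I_8 -> 'Z_5) :
  (forall i j, i != j -> exists x y, forall s t,
    #|[pred c | (a i c - a j c == s) && (b i c - b j c == t)]|
      = ((s == x) + (t == y))%N) ->
  exists2 sg : 'I_8 -> 'I_8, injective sg & forall i j, i != j ->
    b i (sg i) - b j (sg i) = b i (sg j) - b j (sg j) /\
    forall (F : comPzRingType) (h : 'Z_5 -> F),
      \sum_c h (b i c - b j c) = \sum_t h t + 3%:R * h (b i (sg j) - b j (sg j)).
Proof.
move=> abP.
have aP : rows_delta a.
  by move=> i j /abP[x [y /triangle_pentagon_delta[u [v uvP]]]]; exists x, u, v.
have [e [r [sg [e0 sgI aE]]]] := rows_delta_star aP.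
exists sg => // i j ij; have [x [y xyP]] := abP i j ij.
have aij c : a i c - a j c = r i - r j + e * (delta (sg j) c - delta (sg i) c).
  transitivity ((a i c - a ord0 c) - (a j c - a ord0 c)); first by ring.
  by rewrite !aE; ring.
have xE : x = r i - r j.
  have [u [v [_ uvP]]] := triangle_pentagon_delta xyP.
  have [c] := @ord8_avoid [:: u; v; sg i; sg j] isT.
  rewrite !inE !negb_or => /and4P[/negPf cu /negPf cv /negPf ci /negPf cj].
  by have := aij c; rewrite uvP cu cv ci cj !subrr mulr0 !addr0.
have off c : delta (sg j) c - delta (sg i) c != 0 -> b i c - b j c = y.
  move=> cij; apply: (triangle_pentagon_off xyP).
  rewrite aij xE -subr_eq0 addrC addKr.
  by case: e e0 cij {aE aij} => [[|[|[|//]]] ?]; case: (_ - _) => [[|[|[|//]]] ?].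
have ne : sg i == sg j = false by apply/negbTE; rewrite (inj_eq sgI).
rewrite !off ?eqxx ?ne ?[sg j == _]eq_sym ?ne //; split=> // F h.
exact: (triangle_pentagon_sum xyP h).
Qed.

Lemma no_Butson_8_15 (C : numClosedFieldType) (H : 'M[C]_8) :
  (forall i j, 15.-unity_root (H i j)) ->
  (forall i j, i != j -> \sum_c H i c * (H j c)^* = 0) -> False.
Proof.
move=> Hu HH; have [z zP] := closed_prim_root_exists C (isT : (0 < 15)%N).
pose e i j : nat := sval (prim_rootP zP (unity_rootP (Hu i j))).
have HE i j : H i j = z ^+ e i j by rewrite /e; case: prim_rootP.
pose a i j : 'Z_3 := (e i j)%:R; pose b i j : 'Z_5 := (e i j)%:R.
have abP i j : i != j -> exists x y, forall s t,
    #|[pred c | (a i c - a j c == s) && (b i c - b j c == t)]|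
      = ((s == x) + (t == y))%N.
  (* Conjugation negates exponents, and $14 = -1$ mod 15. *)
  move=> ij; pose k c := (e i c + e j c * 14)%N.
  have [||x [y xyP]] := @vanishing_sum8 _ z _ k zP; first by rewrite card_ord.
    rewrite -[RHS](HH i j ij); apply: eq_bigr => c _.
    by rewrite (conjC_unity_root (Hu j c)) !HE exprD exprM.
  have k3 c : (k c)%:R = a i c - a j c.
    by rewrite natrD natrM (_ : 14%:R = -1 :> 'Z_3) ?mulrN1 //; apply/val_inj.
  have k5 c : (k c)%:R = b i c - b j c.
    by rewrite natrD natrM (_ : 14%:R = -1 :> 'Z_5) ?mulrN1 //; apply/val_inj.
  by exists x, y => s t; rewrite -xyP; apply: eq_card => c; rewrite !inE k3 k5.
have [sg sgI bP] := triangle_pentagon_rows abP.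
pose w := z ^+ 3.
have wP : 5.-primitive_root w by exact: (dvdn_prim_root zP (isT : 5 %| 15)%N).
pose h (t : 'Z_5) := w ^+ t.
have hD s t : h (s + t) = h s * h t by rewrite /h -exprD -(prim_expr_mod wP (s + t)).
have h0 : \sum_t h t = 0.
  have w1 : w - 1 != 0 by rewrite subr_eq0 -(prim_order_dvd wP 1).
  by apply: (mulfI w1); rewrite mulr0 -[LHS](subrX1 w 5) (prim_expr_order wP) subrr.
pose E i j := b i (sg j) - b j (sg j).
have EC i j : E i j = - E j i.
  have [->|ij] := eqVneq i j; first by rewrite /E subrr oppr0.
  by have [bij _] := bP i j ij; rewrite /E -bij opprB.
pose M : 'M[C]_8 := \matrix_(i, j) h (E i j).
apply: (@no_quadratic_trace _ M).
  apply/matrixP => i j; rewrite !mxE.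
  (* $E_{ic} + E_{cj} = E_{ic} - E_{jc}$, in which the terms in [b c] cancel, leaving column [sg c]
     of rows [i] and [j]. *)
  have -> : \sum_c M i c * M c j = \sum_c h (b i c - b j c).
    rewrite [RHS](reindex_inj sgI); apply: eq_bigr => c _.
    by rewrite !mxE -hD [E c j]EC /E; congr h; ring.
  have [->|ij] := eqVneq i j; last by rewrite (bP i j ij).2 h0 add0r addr0.
  (* On the diagonal the identity reads $8 = 3 + 5$. *)
  rewrite (eq_bigr (fun=> 1)) => [|c _]; last by rewrite subrr.
  by rewrite sumr_const card_ord /E subrr mulr1 -natrD.
rewrite /mxtrace (eq_bigr (fun=> 1)) => [|i _]; last by rewrite mxE /E subrr.
by rewrite sumr_const card_ord.
Qed.

Lemma BH_8_15_empty (R : realType) (H : 'M[R[i]]_8) : ~ BH R 8 15 H.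
Proof.
move=> [Hu HH]; apply: (no_Butson_8_15 Hu) => i j ij.
have := congr1 (fun A : 'M_8 => A i j) HH; rewrite !mxE (negPf ij) mulr0n => HHij.
by rewrite -[RHS]HHij; apply: eq_bigr => c _; rewrite !mxE.
Qed.

End Butson.

Local Open Scope classical_set_scope.

Theorem mainTheorem7 (R : realType) : BH R 8 15 = set0.
Proof. by apply/seteqP; split=> // H /BH_8_15_empty. Qed.
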